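(* Let $k$ be a complete non-archimedean field with non-trivial absolute value and ring of integers $k^\circ$. Let $\mathcal{A}$ be a torsion-free $k^\circ$-algebra of finite type and $A=\mathcal{A}\otimes_{k^\circ}k$ (so $\mathcal{A}\subset A$). For $f\in A$ define $\|f\|_{\mathcal{A}}=\inf\{|\lambda| : \lambda\in k^\times,\ f/\lambda\in\mathcal{A}\}$. Then $\|f\|_{\mathcal{A}}\in|k|$ for every $f\in A$.
   Context: $|k|$ denotes the set $\{|a|: a\in k\}$ of absolute values of elements of $k$ (including $0$). *)

(* Defs.v *)
From HB Require Import structures.
From Stdlib Require Import Reals.
From mathcomp Require Import all_boot all_order all_algebra.
Set Implicit Arguments. Unset Strict Implicit. Unset Printing Implicit Defensive.
Import GRing.Theory.
Local Open Scope ring_scope.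

Definition nonarch_abs (K : fieldType) (abs : K -> R) : Prop :=
  (forall x : K, Rle R0 (abs x)) /\
  (forall x : K, abs x = R0 <-> x = 0) /\
  (forall x y : K, abs (x * y) = Rmult (abs x) (abs y)) /\
  (forall x y : K, Rle (abs (x + y)) (Rmax (abs x) (abs y))).

Definition nontrivial_abs (K : fieldType) (abs : K -> R) : Prop :=
  exists x : K, abs x <> R0 /\ abs x <> R1.

Definition complete_abs (K : fieldType) (abs : K -> R) : Prop :=
  forall u : nat -> K,
    (forall eps : R, Rlt R0 eps -> exists N : nat, forall m n : nat,
        (N <= m)%N -> (N <= n)%N -> Rlt (abs (u m - u n)) eps) ->
    exists l : K, forall eps : R, Rlt R0 eps -> exists N : nat, forall n : nat,
        (N <= n)%N -> Rlt (abs (u n - l)) eps.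

Definition kcirc (K : fieldType) (abs : K -> R) (c : K) : Prop := Rle (abs c) R1.

Inductive gen_alg (K : fieldType) (abs : K -> R) (A : comAlgType K)
    (gens : seq A) : A -> Prop :=
  | gen_alg_gen : forall g, g \in gens -> gen_alg abs gens g
  | gen_alg_scal : forall c : K, kcirc abs c -> gen_alg abs gens (c%:A)
  | gen_alg_add : forall x y, gen_alg abs gens x -> gen_alg abs gens y ->
                    gen_alg abs gens (x + y)
  | gen_alg_mul : forall x y, gen_alg abs gens x -> gen_alg abs gens y ->
                    gen_alg abs gens (x * y).

Definition norm_set (K : fieldType) (abs : K -> R) (A : comAlgType K)
    (gens : seq A) (f : A) (r : R) : Prop :=
  exists lam : K, lam != 0 /\ gen_alg abs gens (lam^-1 *: f) /\ r = abs lam.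

Definition is_inf (S : R -> Prop) (r : R) : Prop :=
  (forall s, S s -> Rle r s) /\
  (forall b, (forall s, S s -> Rle b s) -> Rle b r).

(* Main.v *)
Require Import Defs.
From HB Require Import structures.
From Stdlib Require Import Reals Lra Classical.
From mathcomp Require Import all_boot all_order all_algebra.
From mathcomp Require Import mpoly.

(** A Gröbner basis argument for the Gauss norm.  Write A as a quotient of a
    polynomial ring by an ideal I, so that the norm of f measures the distance
    to I of a lift of f.  Order monomials by degrevlex, and call dominant the
    largest monomial whose coefficient has maximal absolute value.  By Dickson's
    lemma finitely many elements of I account for the dominant monomials of I;
    their finitely many coefficients of absolute value < 1 are bounded by some
    rho < 1.  Division by these elements writes any polynomial as g + h + e with
    g in I, e at most rho times as large, and h free of dominant monomials of I,
    so that the distance from h to I is exactly the Gauss norm of h.  Iterating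
    until e is smaller than the norm of f shows that this norm, if nonzero, is
    the absolute value of a coefficient. *)

Set Implicit Arguments.
Unset Strict Implicit.
Unset Printing Implicit Defensive.
Import Order.TTheory GRing.Theory.
Local Open Scope ring_scope.

(** * Dickson's lemma *)

(** Induction on [n]: a basis [s0] for the first [n] exponents already covers every element whose
    last exponent is at least the maximum [M] of that exponent over [s0], and each of the finitely
    many slices below [M] gets its own basis. Abstract exponent functions [e] let the induction drop
    a coordinate without changing [T]. *)
Lemma Dickson (T : eqType) (n : nat) (e : nat -> T -> nat) (P : T -> Prop) :
  exists s : seq T, (forall a, a \in s -> P a) /\
    forall x, P x -> exists2 a, a \in s &
      forall i, (i < n)%N -> (e i a <= e i x)%N.
Proof.
elim: n P => [|n IHn] P.
  have [[x Px]|noP] := classic (exists x, P x).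
    by exists [:: x]; split=> [a|y _]; [rewrite inE => /eqP-> | exists x; rewrite ?inE].
  by exists [::]; split=> // x Px; case: noP; exists x.
have [s0 [Ps0 s0P]] := IHn P.
pose M := (\max_(a <- s0) e n a)%N.
have /(_ M)[s1 [Ps1 s1P]] : forall k, exists s : seq T, (forall a, a \in s -> P a) /\
    forall x, P x -> (e n x < k)%N -> exists2 a, a \in s &
      forall i, (i < n.+1)%N -> (e i a <= e i x)%N.
  elim=> [|k [s [Ps sP]]]; first by exists [::].
  have [t [Pt tP]] := IHn (fun x => P x /\ e n x = k).
  exists (s ++ t); split=> [a|x Px].
    by rewrite mem_cat => /orP[/Ps|/Pt[]].
  rewrite ltnS leq_eqVlt => /orP[/eqP ex|/sP[] // a a_s le_ax]; last first.
    by exists a; rewrite // mem_cat a_s.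
  have [a a_t le_ax] := tP x (conj Px ex).
  exists a; first by rewrite mem_cat a_t orbT.
  move=> i; rewrite ltnS leq_eqVlt => /orP[/eqP->|/le_ax//].
  by have [_ ->] := Pt a a_t; rewrite ex.
exists (s0 ++ s1); split=> [a|x Px].
  by rewrite mem_cat => /orP[/Ps0|/Ps1].
have [ltxM|leMx] := ltnP (e n x) M.
  by have [a a_s1 le_ax] := s1P x Px ltxM; exists a; rewrite // mem_cat a_s1 orbT.
have [a a_s0 le_ax] := s0P x Px; exists a; first by rewrite mem_cat a_s0.
move=> i; rewrite ltnS leq_eqVlt => /orP[/eqP->|/le_ax//].
by apply: leq_trans leMx; rewrite /M (big_rem a) //= leq_maxl.
Qed.

Lemma Dickson_mnm (n : nat) (P : 'X_{1..n} -> Prop) :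
  exists s : seq 'X_{1..n}, (forall a, a \in s -> P a) /\
    forall m, P m -> exists2 a, a \in s & (a <= m)%MM.
Proof.
have [s [Ps sP]] := Dickson n (fun i (m : 'X_{1..n}) => nth 0%N m i) P.
exists s; split=> // m /sP[a a_s le_am]; exists a => //.
by apply/mnm_lepP => i; rewrite !(mnm_nth 0%N) le_am.
Qed.

(** * Non-archimedean absolute values *)

Section AbsoluteValue.

Variables (K : fieldType) (abs : K -> R).
Hypothesis Habs : nonarch_abs abs.

Lemma abs_ge0 x : Rle R0 (abs x). Proof. by case: Habs. Qed.

Lemma abs_eq0 x : abs x = R0 <-> x = 0. Proof. by case: Habs => _ []. Qed.

Lemma abs0 : abs 0 = R0. Proof. exact/abs_eq0. Qed.

Lemma abs_gt0 x : x != 0 -> Rlt R0 (abs x).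
Proof.
by move=> /eqP nz_x; case: (abs_ge0 x) => // /esym /abs_eq0.
Qed.

Lemma absM x y : abs (x * y) = Rmult (abs x) (abs y).
Proof. by case: Habs => _ [_ []]. Qed.

Lemma abs1 : abs 1 = R1.
Proof.
have := absM 1 1; have := abs_gt0 (oner_neq0 K); rewrite mulr1.
by move: (abs 1) => u gt0 sq; apply: (Rmult_eq_reg_l u); lra.
Qed.

Lemma absN x : abs (- x) = abs x.
Proof.
have abs_N1 : abs (-1) = R1.
  have := absM (-1) (-1); have := abs_ge0 (-1).
  by rewrite mulrNN mulr1 abs1 => ? ?; nra.
by rewrite -mulN1r absM abs_N1; lra.
Qed.

Lemma absV x : x != 0 -> abs x^-1 = Rinv (abs x).
Proof.
move=> nz_x; have gt0 := abs_gt0 nz_x; apply: (Rmult_eq_reg_l (abs x)); last lra.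
by rewrite -absM divff // abs1 Rinv_r //; lra.
Qed.

Lemma absD_le x y r : Rle (abs x) r -> Rle (abs y) r -> Rle (abs (x + y)) r.
Proof.
have [_ [_ [_ /(_ x y) h]]] := Habs; move=> xr yr.
exact: Rle_trans h (Rmax_lub _ _ _ xr yr).
Qed.

Lemma absB_le x y r : Rle (abs x) r -> Rle (abs y) r -> Rle (abs (x - y)) r.
Proof. by move=> xr yr; apply: absD_le; rewrite ?absN. Qed.

Lemma absD_lt x y r : Rlt (abs x) r -> Rlt (abs y) r -> Rlt (abs (x + y)) r.
Proof.
have [_ [_ [_ /(_ x y) h]]] := Habs; move=> xr yr.
exact: Rle_lt_trans h (Rmax_lub_lt _ _ _ xr yr).
Qed.

Lemma absX x k : abs (x ^+ k) = pow (abs x) k.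
Proof.
by elim: k => [|k IHk]; rewrite ?expr0 ?abs1 // exprS absM IHk.
Qed.

Lemma abs_small : nontrivial_abs abs -> forall eps, Rlt R0 eps ->
  exists2 x : K, x != 0 & Rlt (abs x) eps.
Proof.
case=> x [nz_absx absx_neq1] eps eps_gt0.
have nz_x : x != 0 by apply/eqP => /abs_eq0.
have [y nz_y y_lt1] : exists2 y, y != 0 & Rlt (abs y) R1.
  have gt0 := abs_gt0 nz_x.
  case: (Rtotal_order (abs x) R1) => [|[//|x_gt1]]; first by exists x.
  exists x^-1; rewrite ?invr_eq0 // absV //.
  by apply: (Rmult_lt_reg_l (abs x)) => //; rewrite Rinv_r; lra.
have [|N ltN] := pow_lt_1_zero (abs y) _ _ eps_gt0.
  by rewrite Rabs_pos_eq //; exact: abs_ge0.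
exists (y ^+ N); first by rewrite expf_neq0.
rewrite absX; apply: Rle_lt_trans (ltN N _); last by [].
exact: Rle_abs.
Qed.

(** * Gauss norm and dominant monomials *)

Variable n : nat.
Implicit Types (p q g h : {mpoly K[n]}) (m a : 'X_{1..n}) (r C : R).

Definition gauss_le p r := forall m, Rle (abs p@_m) r.

Lemma gauss_leD {p q r} : gauss_le p r -> gauss_le q r -> gauss_le (p + q) r.
Proof. by move=> pr qr m; rewrite mcoeffD; apply: absD_le. Qed.

Lemma gauss_leB {p q r} : gauss_le p r -> gauss_le q r -> gauss_le (p - q) r.
Proof. by move=> pr qr m; rewrite mcoeffB; apply: absB_le. Qed.

Lemma gauss_le0 r : Rle R0 r -> gauss_le 0 r.
Proof. by move=> r0 m; rewrite mcoeff0 abs0. Qed.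

Lemma gauss_leZ c p r : gauss_le p r -> gauss_le (c *: p) (Rmult (abs c) r).
Proof.
move=> pr m; rewrite mcoeffZ absM; apply: Rmult_le_compat_l => //.
exact: abs_ge0.
Qed.

Lemma gauss_leM p q : gauss_le p R1 -> gauss_le q R1 -> gauss_le (p * q) R1.
Proof.
move=> p1 q1 m; rewrite mcoeffM.
apply: (big_ind (fun x => Rle (abs x) R1)) => [||k _].
- by rewrite abs0; lra.
- by move=> x y; apply: absD_le.
rewrite absM; apply: Rle_trans (Rmult_le_compat _ _ _ _ _ _ (p1 _) (q1 _)) _.
- exact: abs_ge0.
- exact: abs_ge0.
by lra.
Qed.

(* Reducing a polynomial of Gauss norm 1 modulo the maximal ideal, its
   dominant monomial becomes the leading monomial of the reduction. *)
Definition dominant p a := p@_a != 0 /\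
  forall m, Rle (abs p@_m) (abs p@_a) /\
    ((a < m)%O -> Rlt (abs p@_m) (abs p@_a)).

Lemma dominant_exists p : p != 0 -> exists a, dominant p a.
Proof.
rewrite -msupp_eq0 => supp_p.
have [a a_p dom_a] : exists2 a, a \in msupp p & forall m, m \in msupp p ->
    Rle (abs p@_m) (abs p@_a) /\ ((a < m)%O -> Rlt (abs p@_m) (abs p@_a)).
  elim: (msupp p) supp_p => // x [|y s] IHs _.
    exists x; rewrite ?inE // => m; rewrite inE => /eqP->.
    by split; [lra | rewrite ltxx].
  have [a a_s dom_a] := IHs isT.
  have [ltxa|leax] : (Rlt (abs p@_x) (abs p@_a) \/ abs p@_x = abs p@_a /\ (x <= a)%O)
      \/ (Rlt (abs p@_a) (abs p@_x) \/ abs p@_x = abs p@_a /\ (a < x)%O).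
    case: (Rtotal_order (abs p@_x) (abs p@_a)) => [|[->|]]; try tauto.
    by have [lexa|ltax] := leP x a; [left | right]; right.
  - exists a; first by rewrite inE a_s orbT.
    move=> m; rewrite inE => /orP[/eqP->|/dom_a//].
    case: ltxa => [|[-> lexa]]; first by split; lra.
    by split; [lra | rewrite ltNge lexa].
  - exists x; first by rewrite inE eqxx.
    move=> m; rewrite inE => /orP[/eqP->|/dom_a[le_ma lt_ma]].
      by split; [lra | rewrite ltxx].
    case: leax => [|[eq_xa ltax]]; first by split=> *; lra.
    by split=> [|ltxm]; [lra | have := lt_ma (lt_trans ltax ltxm); lra].
have nz_pa : p@_a != 0 by rewrite -mcoeff_msupp.
exists a; split=> // m; have [/dom_a //|m_p] := boolP (m \in msupp p).
by rewrite (memN_msupp_eq0 m_p) abs0; have := abs_gt0 nz_pa; split; lra.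
Qed.

Lemma max_coeff_exists p : exists a, gauss_le p (abs p@_a).
Proof.
have [->|/dominant_exists[a [_ dom_a]]] := eqVneq p 0.
  by exists 0%MM => m; rewrite !mcoeff0; lra.
by exists a => m; case: (dom_a m).
Qed.

(** * Approximate division modulo an ideal *)

Variable I : {mpoly K[n]} -> Prop.
Hypothesis I0 : I 0.
Hypothesis ID : forall p q, I p -> I q -> I (p + q).
Hypothesis IM : forall p q, I p -> I (q * p).

(** The dominant monomials of members of [I], after scaling the dominant coefficient to 1. *)
Definition lead_mon a := exists g, [/\ I g, g@_a = 1 & forall m,
  Rle (abs g@_m) R1 /\ ((a < m)%O -> Rlt (abs g@_m) R1)].

Definition lead_mon_le rho a := exists g, [/\ I g, g@_a = 1 & forall m,
  Rle (abs g@_m) R1 /\ ((a < m)%O -> Rle (abs g@_m) rho)].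

Definition normal_form h := forall m, h@_m != 0 -> ~ lead_mon m.

Definition approx p r :=
  exists g h, [/\ I g, normal_form h & gauss_le (p - g - h) r].

(** A polynomial has finitely many nonzero coefficients, so those of [g] above [a] have a maximum,
    still below 1. *)
Lemma lead_mon_leW a : lead_mon a ->
  exists2 rho, Rle R0 rho /\ Rlt rho R1 & lead_mon_le rho a.
Proof.
case=> g [Ig ga domg].
have [rho rho01 le_rho] : exists2 rho, Rle R0 rho /\ Rlt rho R1 &
    forall m, m \in msupp g -> (a < m)%O -> Rle (abs g@_m) rho.
  elim: (msupp g) => [|x s [rho rho01 le_rho]].
    by exists R0 => //; lra.
  have [ltax|leax] := boolP (a < x)%O; last first.
    exists rho => // m; rewrite inE => /orP[/eqP->|/le_rho//].
    by rewrite (negbTE leax).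
  exists (Rmax rho (abs g@_x)).
    have := Rmax_l rho (abs g@_x); split; first lra.
    by apply: Rmax_lub_lt; [lra | case: (domg x) => _; apply].
  move=> m; rewrite inE => /orP[/eqP->|/le_rho h /h le_m].
    by move=> _; apply: Rmax_r.
  exact: Rle_trans le_m (Rmax_l _ _).
exists rho => //; exists g; split=> // m; split; first by case: (domg m).
move=> ltam; have [/le_rho|m_g] := boolP (m \in msupp g); first exact.
by rewrite (memN_msupp_eq0 m_g) abs0; lra.
Qed.

(* Dickson's lemma makes finitely many generators suffice, so that the
   coefficients of absolute value < 1 are bounded away from 1. *)
Lemma lead_mon_uniform : exists2 rho, Rle R0 rho /\ Rlt rho R1 &
  forall m, lead_mon m -> exists2 a, (a <= m)%MM & lead_mon_le rho a.
Proof.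
have [s [Ls sP]] := Dickson_mnm lead_mon.
have [rho rho01 Lrho] : exists2 rho, Rle R0 rho /\ Rlt rho R1 &
    forall a, a \in s -> lead_mon_le rho a.
  elim: s Ls {sP} => [|x s IHs] Ls; first by exists R0 => //; lra.
  have [a a_s|rho rho01 Lrho] := IHs; first by apply: Ls; rewrite inE a_s orbT.
  have [|rhox rhox01 Lx] := @lead_mon_leW x; first by apply: Ls; rewrite inE eqxx.
  have mono rho1 rho2 b : Rle rho1 rho2 -> lead_mon_le rho1 b -> lead_mon_le rho2 b.
    move=> le12 [g [Ig gb domg]]; exists g; split=> // m.
    by case: (domg m) => g1 gr; split=> // /gr; lra.
  exists (Rmax rho rhox); first by have := Rmax_l rho rhox; split;
    [lra | apply: Rmax_lub_lt; lra].
  move=> a; rewrite inE => /orP[/eqP->|/Lrho].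
    by apply: mono Lx; apply: Rmax_r.
  by apply: mono; apply: Rmax_l.
by exists rho => // m /sP[a a_s le_am]; exists a; last exact: Lrho.
Qed.

Lemma normal_form0 : normal_form 0.
Proof. by move=> m; rewrite mcoeff0 eqxx. Qed.

Lemma normal_formD h1 h2 : normal_form h1 -> normal_form h2 -> normal_form (h1 + h2).
Proof.
move=> N1 N2 m; rewrite mcoeffD.
have [->|/N1//] := eqVneq h1@_m 0; rewrite add0r; exact: N2.
Qed.

Lemma normal_formZ c h : normal_form h -> normal_form (c *: h).
Proof.
by move=> Nh m; rewrite mcoeffZ mulf_eq0 negb_or => /andP[_ /Nh].
Qed.

Lemma gauss_le_approx p r : gauss_le p r -> approx p r.
Proof. by exists 0, 0; split; rewrite ?subr0 //; exact: normal_form0. Qed.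

Lemma approxD p q r : approx p r -> approx q r -> approx (p + q) r.
Proof.
move=> [g1 [h1 [I1 N1 le1]]] [g2 [h2 [I2 N2 le2]]].
exists (g1 + g2), (h1 + h2); split; [exact: ID | exact: normal_formD |].
have -> : p + q - (g1 + g2) - (h1 + h2) = (p - g1 - h1) + (q - g2 - h2).
  by rewrite !opprD (addrACA p) (addrACA (p - g1)).
exact: gauss_leD.
Qed.

Lemma approxZ c p r : approx p r -> approx (c *: p) (Rmult (abs c) r).
Proof.
move=> [g [h [Ig Nh le]]]; exists (c *: g), (c *: h); split.
- by rewrite -mul_mpolyC; apply: IM.
- exact: normal_formZ.
by rewrite -!scalerBr; apply: gauss_leZ.
Qed.

Lemma approx_sum (T : eqType) (s : seq T) (F : T -> {mpoly K[n]}) r :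
  Rle R0 r -> (forall x, x \in s -> approx (F x) r) -> approx (\sum_(x <- s) F x) r.
Proof.
move=> r0 Fr; rewrite big_seq; elim/big_ind: _ => //.
- by apply: gauss_le_approx; apply: gauss_le0.
- by move=> p q; apply: approxD.
Qed.

Lemma approx_le p r C : Rle r C -> approx p r -> approx p C.
Proof.
by move=> rC [g [h [Ig Nh le]]]; exists g, h; split=> // m; have := le m; lra.
Qed.

(** Well-founded induction on the monomial order. A monomial outside [lead_mon] is its own normal
    form; any other is cancelled by a multiple [q] of a generator, and the terms of the tail either
    go into the error or fall under the induction hypothesis. *)
Lemma approx_mnm rho :
  Rle R0 rho -> Rlt rho R1 ->
  (forall m, lead_mon m -> exists2 a, (a <= m)%MM & lead_mon_le rho a) ->
  forall m, approx 'X_[m] rho.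
Proof.
move=> rho0 rho1 Hlead; apply: ltmwf => m IHm.
have [/Hlead[a le_am [g [Ig ga domg]]]|nLm] := classic (lead_mon m); last first.
  exists 0, 'X_[m]; split=> //.
    by move=> k; rewrite mcoeffX; have [<-|] := eqVneq m k; rewrite ?eqxx.
  by rewrite subr0 subrr; apply: gauss_le0.
pose b := (m - a)%MM; pose q := g * 'X_[b].
have Iq : I q by rewrite /q mulrC; apply: IM.
have Em : m = (b + a)%MM by rewrite /b submK.
have qm : q@_m = 1 by rewrite Em mcoeffMX.
(* The order is compatible with products of monomials, so shifting by [b] carries the bounds on [g]
   around [a] over to [q] around [m]. *)
have domq k : Rle (abs q@_k) R1 /\ ((m < k)%O -> Rle (abs q@_k) rho).
  have [k_q|k_q] := boolP (k \in msupp q); last first.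
    by rewrite (memN_msupp_eq0 k_q) abs0; lra.
  move: k_q; rewrite (perm_mem (msuppMX _ _)) => /mapP[k' _ ->].
  by rewrite mcoeffMX Em ltmc_add2r; exact: domg.
have -> : 'X_[m] = q + \sum_(k <- msupp ('X_[m] - q)) ('X_[m] - q)@_k *: 'X_[k].
  by rewrite -mpolyE addrC subrK.
apply: approxD.
  by exists q, 0; split=> //; [exact: normal_form0 | rewrite subr0 subrr; apply: gauss_le0].
apply: approx_sum => // k _; rewrite mcoeffB mcoeffX.
have [q1 qr] := domq k.
have [<-|neq_mk] := eqVneq m k.
  by rewrite qm subrr scale0r; apply/gauss_le_approx/gauss_le0.
rewrite sub0r; case: (ltgtP k m) neq_mk => [ltkm _|ltmk _|-> //].
  (* Below [m] the coefficient is at most 1 in absolute value, so scaling does not enlarge the error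
     [rho]. *)
  apply: approx_le (approxZ _ (IHm k ltkm)).
  by rewrite absN; have := abs_ge0 q@_k; nra.
(* Above [m] the coefficient is at most [rho]: the whole term is error. *)
apply: gauss_le_approx => j; rewrite mcoeffZ absM absN mcoeffX.
have := qr ltmk; have := abs_ge0 q@_k.
by case: (k == j); rewrite ?abs1 ?abs0; lra.
Qed.

Lemma approx_pow : exists2 rho, Rle R0 rho /\ Rlt rho R1 &
  forall p C, gauss_le p C -> forall N, approx p (Rmult (pow rho N) C).
Proof.
have [rho [rho0 rho1] Hlead] := lead_mon_uniform.
exists rho => // p C leC.
have step q r : gauss_le q r -> approx q (Rmult rho r).
  move=> qr; have r0 : Rle R0 r by apply: Rle_trans (qr 0%MM); apply: abs_ge0.
  rewrite (mpolyE q); apply: approx_sum => [|m _]; first by nra.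
  apply: approx_le (approxZ _ (approx_mnm rho0 rho1 Hlead m)).
  by have := Rmult_le_compat_r _ _ _ rho0 (qr m); lra.
elim=> [|N [g [h [Ig Nh le_N]]]] /=.
  by apply: gauss_le_approx; rewrite Rmult_1_l.
(* Only the error [p - g - h] is divided again; [h] and [g] decompose exactly. *)
rewrite -[p](subrK g) -[p - g](subrK h) Rmult_assoc.
have pos : Rle R0 (Rmult rho (Rmult (pow rho N) C)).
  by apply: Rmult_le_pos => //; apply: Rle_trans (le_N 0%MM); apply: abs_ge0.
apply: approxD; first apply: approxD; first exact: step.
- by exists 0, h; split=> //; rewrite subr0 subrr; apply: gauss_le0.
exists g, 0; split=> //; [exact: normal_form0 | rewrite subr0 subrr; exact: gauss_le0].
Qed.

(* Were h - g smaller than h, then g would inherit the dominant monomial of h. *)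
Lemma normal_form_dist h g r :
  normal_form h -> I g -> gauss_le (h - g) r -> gauss_le h r.
Proof.
move=> Nh Ig le_r m; apply: NNPP => /Rnot_le_lt lt_rm.
have r0 : Rle R0 r by apply: Rle_trans (le_r m); apply: abs_ge0.
have nz_h : h != 0.
  by apply/eqP => h0; move: lt_rm; rewrite h0 mcoeff0 abs0; lra.
have [a [nz_ha dom_a]] := dominant_exists nz_h.
have lt_ra : Rlt r (abs h@_a) by have [? _] := dom_a m; lra.
have gE k : g@_k = h@_k - (h - g)@_k by rewrite -mcoeffB opprB addrC subrK.
have le_g k : Rle (abs g@_k) (abs h@_a).
  by rewrite gE; apply: absB_le; [case: (dom_a k) | have := le_r k; lra].
have lt_g k : (a < k)%O -> Rlt (abs g@_k) (abs h@_a).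
  move=> ltak; rewrite gE; apply: absD_lt; first by case: (dom_a k) => _; apply.
  by rewrite absN; have := le_r k; lra.
have eq_ga : abs g@_a = abs h@_a.
  apply: Rle_antisym => //; apply: NNPP => /Rnot_le_lt lt_ga.
  suff : Rlt (abs h@_a) (abs h@_a) by lra.
  rewrite -{1}[h@_a](subrK g@_a) -mcoeffB; apply: absD_lt => //.
  by have := le_r a; lra.
have ha_gt0 := abs_gt0 nz_ha.
have nz_ga : g@_a != 0 by apply/eqP => /abs_eq0; lra.
case: (Nh a nz_ha); exists ((g@_a)^-1 *: g); split.
- by rewrite -mul_mpolyC; apply: IM.
- by rewrite mcoeffZ mulVf.
move=> k; rewrite mcoeffZ absM absV // eq_ga; split=> [|ltak].
  apply: (Rmult_le_reg_l (abs h@_a)) => //; rewrite -Rmult_assoc Rinv_r; last lra.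
  by have := le_g k; lra.
apply: (Rmult_lt_reg_l (abs h@_a)) => //; rewrite -Rmult_assoc Rinv_r; last lra.
by have := lt_g k ltak; lra.
Qed.

End AbsoluteValue.

(** * Presentation of the algebra by polynomials *)

Section Evaluation.

Variables (K : fieldType) (abs : K -> R) (A : comAlgType K) (gens : seq A).
Hypothesis Habs : nonarch_abs abs.

Definition gens_eval (p : {mpoly K[size gens]}) : A :=
  mmap (GRing.in_alg A) (tnth (in_tuple gens)) p.

Lemma gens_evalD p q : gens_eval (p + q) = gens_eval p + gens_eval q.
Proof. exact: mmapD. Qed.

Lemma gens_evalB p q : gens_eval (p - q) = gens_eval p - gens_eval q.
Proof. exact: mmapB. Qed.

Lemma gens_evalZ c p : gens_eval (c *: p) = c *: gens_eval p.
Proof. by rewrite /gens_eval mmapZ /= mulr_algl. Qed.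

Lemma gens_evalM p q : gens_eval (p * q) = gens_eval p * gens_eval q.
Proof. exact: (mmap_is_multiplicative _ _).1. Qed.

Lemma gen_alg1 : gen_alg abs gens 1.
Proof.
by rewrite -[1]scale1r; apply: gen_alg_scal; rewrite /kcirc abs1 //; lra.
Qed.

(** Turns membership in the integral algebra into a Gauss norm bound on a lift: such lifts are
    closed under each constructor, and conversely a polynomial with integral coefficients evaluates
    to a sum of products of constructors. *)
Lemma gen_algP x : gen_alg abs gens x <->
  exists2 p : {mpoly K[size gens]}, gauss_le abs p R1 & gens_eval p = x.
Proof.
split=> [|[p p1 <-]].
  elim=> {x} [g g_s|c c1|x y _ [p p1 <-] _ [q q1 <-]|x y _ [p p1 <-] _ [q q1 <-]].
  - have lt_i : (index g gens < size gens)%N by rewrite index_mem.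
    exists 'X_(Ordinal lt_i) => [m|].
      by rewrite mcoeffX; case: (_ == _); rewrite ?abs0 ?abs1 //; lra.
    by rewrite /gens_eval mmapX mmap1U (tnth_nth 0) /= nth_index.
  - exists c%:MP => [m|]; last by rewrite /gens_eval mmapC.
    rewrite mcoeffC absM //; have := abs_ge0 Habs c; move: c1; rewrite /kcirc.
    by case: (_ == _); rewrite ?abs0 ?abs1 //; lra.
  - by exists (p + q); [exact: gauss_leD | rewrite gens_evalD].
  - by exists (p * q); [exact: gauss_leM | rewrite gens_evalM].
rewrite /gens_eval /mmap; elim/big_ind: _ => [||m _].
- rewrite -(scale0r 1); apply: gen_alg_scal; rewrite /kcirc abs0 //; lra.
- exact: gen_alg_add.
apply: gen_alg_mul; first exact/gen_alg_scal/p1.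
rewrite /mmap1; elim/big_ind: _ => [||i _]; first exact: gen_alg1.
  exact: gen_alg_mul.
elim: (m i) => [|k IHk]; first by rewrite expr0; exact: gen_alg1.
rewrite exprS; apply: gen_alg_mul => //; apply: gen_alg_gen.
exact: mem_tnth.
Qed.

End Evaluation.

(** * Attaining the infimum *)

Theorem propositionA1 (K : fieldType) (abs : K -> R)
    (Habs : nonarch_abs abs) (Hntriv : nontrivial_abs abs)
    (Hcompl : complete_abs abs)
    (A : comAlgType K) (gens : seq A)
    (HA : forall f : A, exists c : K, c != 0 /\ gen_alg abs gens (c *: f))
    (f : A) :
  exists mu : K, is_inf (norm_set abs gens f) (abs mu).
Proof.
(* Without a positive lower bound the infimum is 0, the absolute value of 0. *)
have [[eps eps_gt0 le_eps]|inf0] := classic (exists2 eps, Rlt R0 eps &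
    forall s, norm_set abs gens f s -> Rle eps s); last first.
  exists 0; rewrite abs0 //; split=> [_ [lam [_ [_ ->]]]|b le_b].
    exact: abs_ge0.
  by apply: NNPP => /Rnot_le_lt b_gt0; apply: inf0; exists b.
pose I (p : {mpoly K[size gens]}) := gens_eval p = 0.
have ID p q : I p -> I q -> I (p + q) by rewrite /I gens_evalD => -> ->; rewrite addr0.
have IM p q : I p -> I (q * p) by rewrite /I gens_evalM => ->; rewrite mulr0.
have I0 : I 0 by rewrite /I -(subrr 0) gens_evalB subrr.
have normP lam (p : {mpoly K[size gens]}) : lam != 0 -> gens_eval p = f -> gauss_le abs p (abs lam) ->
    norm_set abs gens f (abs lam).
  move=> nz_lam pf le_lam; exists lam; do 2!split=> //; apply/gen_algP => //.
  exists (lam^-1 *: p); last by rewrite gens_evalZ pf.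
  have -> : R1 = Rmult (abs lam^-1) (abs lam) by rewrite -absM // mulVf // abs1.
  exact: gauss_leZ.
have [F Ff] : exists F : {mpoly K[size gens]}, gens_eval F = f.
  have [c [nz_c /gen_algP[//|G _ Gf]]] := HA f; exists (c^-1 *: G).
  by rewrite gens_evalZ Gf scalerA mulVf // scale1r.
have [aF leF] := max_coeff_exists Habs F.
have [rho [rho0 rho1] Happrox] := approx_pow Habs I0 ID IM.
have [N small] : exists N, Rlt (Rmult (pow rho N) (abs F@_aF)) eps.
  have C0 := abs_ge0 Habs F@_aF.
  (* Adding 1 keeps the divisor positive even when [F] has Gauss norm 0. *)
  have [||N /(_ N (le_n _))] := pow_lt_1_zero rho _
      (Rdiv eps (Rplus (abs F@_aF) R1)); first by rewrite Rabs_pos_eq.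
    by apply: Rdiv_lt_0_compat => //; lra.
  rewrite Rabs_pos_eq; last exact: pow_le.
  move=> lt_pow; exists N.
  have : Rlt (Rmult (pow rho N) (Rplus (abs F@_aF) R1)) eps.
    have := Rmult_lt_compat_r (Rplus (abs F@_aF) R1) _ _ _ lt_pow.
    by rewrite /Rdiv Rmult_assoc Rinv_l; lra.
  by have := pow_le _ N rho0; lra.
have [g [h [Ig Nh le_N]]] := Happrox F _ leF N.
(* Another lift of [f], since [g] is in the kernel; its Gauss norm will be the infimum. *)
pose P := F - g.
have Pf : gens_eval P = f by rewrite gens_evalB Ff Ig subr0.
have [a leP] := max_coeff_exists Habs P.
have nz_Pa : P@_a != 0.
  (* If [P] had Gauss norm 0, elements of arbitrarily small absolute value would enter the norm set,
     against [eps]. *)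
  apply/eqP => Pa0.
  have [x nz_x lt_x] := abs_small Habs Hntriv eps_gt0.
  suff /le_eps : norm_set abs gens f (abs x) by lra.
  apply: (normP x P) => // m; apply: Rle_trans (leP m) _.
  by rewrite Pa0 abs0 //; exact: abs_ge0.
have inP := normP _ P nz_Pa Pf leP.
exists P@_a; split=> [s s_in|b]; last exact.
have le_s := le_eps s s_in.
case: s_in => lam [nz_lam [/gen_algP[//|G G1 Gf] s_lam]].
(* [lam *: G] is a competing lift of [f], so it differs from [P] by an element of [I]. As [P - h] is
   smaller than [eps], hence than [s], [h] lies within [s] of [I]; being in normal form it is itself
   bounded by [s], and so is [P]. *)
have leG : gauss_le abs (lam *: G) s.
  have -> : s = Rmult (abs lam) R1 by rewrite s_lam; lra.
  exact: gauss_leZ.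
have leR : gauss_le abs (P - h) s by move=> m; have := le_N m; rewrite -/P; lra.
have IPG : I (P - lam *: G).
  by rewrite /I gens_evalB gens_evalZ Pf Gf scalerA divff // scale1r subrr.
have leh : gauss_le abs h s.
  apply: (normal_form_dist Habs IM Nh IPG).
  have -> : h - (P - lam *: G) = lam *: G - (P - h).
    by rewrite !opprB addrCA.
  exact: gauss_leB.
by have := gauss_leD Habs leR leh a; rewrite subrK.
Qed.
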